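(* Let $R$ be a ring and let $\mathcal{F}$ be an Oka family of right ideals in $R$. Let $\mathcal{F}'$ denote the set of right ideals of $R$ not belonging to $\mathcal{F}$, and let $\operatorname{Max}(\mathcal{F}')$ be the set of elements of $\mathcal{F}'$ that are maximal with respect to inclusion. Then every $I\in\operatorname{Max}(\mathcal{F}')$ is a completely prime right ideal of $R$.
   Context: Rings are associative with $1$, not necessarily commutative. For a right ideal $I$ of $R$ and $a\in R$, put $a^{-1}I:=\{r\in R: ar\in I\}$, a right ideal of $R$. An Oka family of right ideals (right Oka family) in $R$ is a family $\mathcal{F}$ of right ideals of $R$ with $R\in\mathcal{F}$ such that for every right ideal $I$ of $R$ and every $a\in R$: if $I+aR\in\mathcal{F}$ and $a^{-1}I\in\mathcal{F}$, then $I\in\mathcal{F}$. A right ideal $P\subsetneq R$ is completely prime if for all $a,b\in R$ with $aP\subseteq P$, $ab\in P$ implies $a\in P$ or $b\in P$. *)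

(* Defs.v *)
From mathcomp Require Import all_boot all_order all_algebra.
From mathcomp Require Import boolp classical_sets.

Set Implicit Arguments.
Unset Strict Implicit.
Unset Printing Implicit Defensive.

Import GRing.Theory.
Local Open Scope classical_set_scope.
Local Open Scope ring_scope.

(* R : pzRingType, so that the zero ring is allowed. MathComp's idealr is not
   used: it is a proper ideal, closed under multiplication on the left, and
   given by a boolean predicate over a nontrivial ring. *)
Definition right_ideal (R : pzRingType) (I : set R) : Prop :=
  [/\ I 0,
      forall x y : R, I x -> I y -> I (x - y)
    & forall x r : R, I x -> I (x * r)].

(* a^-1 I *)
Definition right_colon (R : pzRingType) (a : R) (I : set R) : set R :=
  [set r | I (a * r)].

(* I + aR *)
Definition add_principal (R : pzRingType) (I : set R) (a : R) : set R :=
  [set x + a * r | x in I & r in [set: R]].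

Definition right_oka_family (R : pzRingType) (F : set (set R)) : Prop :=
  [/\ F `<=` @right_ideal R,
      F [set: R]
    & forall (I : set R) (a : R), right_ideal I ->
        F (add_principal I a) -> F (right_colon a I) -> F I].

(* F' *)
Definition right_ideals_outside (R : pzRingType) (F : set (set R)) :
    set (set R) :=
  [set I | right_ideal I /\ ~ F I].

Definition Max (T : Type) (G : set (set T)) : set (set T) :=
  [set I | G I /\ forall J : set T, G J -> I `<=` J -> J = I].

Definition completely_prime (R : pzRingType) (P : set R) : Prop :=
  [/\ right_ideal P,
      P `<` [set: R]
    & forall a b : R, [set a * p | p in P] `<=` P ->
        P (a * b) -> P a \/ P b].

(* Main.v *)
Require Import Defs.
From mathcomp Require Import all_boot all_order all_algebra.
From mathcomp Require Import boolp classical_sets.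

Import GRing.Theory.
Local Open Scope classical_set_scope.
Local Open Scope ring_scope.

(** Maximality of [I] outside [F] is used in one form only
    ([Max_right_ideals_outside_sub]): a right ideal that contains [I] and also
    an element not in [I] must belong to [F].  Suppose that [a I] is contained
    in [I] and that [a b] lies in [I], with neither [a] nor [b] in [I].  Then
    [I + a R] contains [I] and [a], while [a^-1 I] contains [I] (this is what
    the inclusion of [a I] in [I] says) and [b].  Both are therefore in [F], and
    the Oka property puts [I] in [F], a contradiction.  Properness of [I] is the
    fact that [F] contains the unit ideal. *)

Lemma right_ideal_add_principal (R : pzRingType) (I : set R) (a : R) :
  right_ideal I -> right_ideal (add_principal I a).
Proof.
case=> I0 IB IM; split.
- by exists 0 => //; exists 0 => //; rewrite mulr0 addr0.
- move=> _ _ [x Ix [r _ <-]] [y Iy [s _ <-]].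
  exists (x - y); first exact: IB.
  by exists (r - s) => //; rewrite mulrBr opprD addrACA.
- move=> _ s [x Ix [r _ <-]].
  exists (x * s); first exact: IM.
  by exists (r * s) => //; rewrite mulrDl mulrA.
Qed.

Lemma sub_add_principal (R : pzRingType) (I : set R) (a : R) :
  I `<=` add_principal I a.
Proof. by move=> x Ix; exists x => //; exists 0 => //; rewrite mulr0 addr0. Qed.

Lemma add_principal_gen (R : pzRingType) (I : set R) (a : R) :
  right_ideal I -> add_principal I a a.
Proof.
by case=> I0 _ _; exists 0 => //; exists 1 => //; rewrite mulr1 add0r.
Qed.

Lemma right_ideal_colon (R : pzRingType) (I : set R) (a : R) :
  right_ideal I -> right_ideal (right_colon a I).
Proof.
case=> I0 IB IM; split; rewrite /right_colon /=.
- by rewrite mulr0.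
- by move=> x y Ix Iy; rewrite mulrBr; apply: IB.
- by move=> x r Ix; rewrite mulrA; apply: IM.
Qed.

Lemma Max_right_ideals_outside_sub (R : pzRingType) (F : set (set R))
    (I J : set R) (x : R) :
  Max (right_ideals_outside F) I ->
  right_ideal J -> I `<=` J -> J x -> ~ I x -> F J.
Proof.
move=> [_ maxI] rJ IJ Jx nIx; apply: contrapT => nFJ; apply: nIx.
by rewrite -(maxI J).
Qed.

Theorem theorem3p4 (R : pzRingType) (F : set (set R)) (hF : right_oka_family F)
    (I : set R) (hI : Max (right_ideals_outside F) I) :
  completely_prime I.
Proof.
have [_ FT oka] := hF; have [[rI nFI] _] := hI.
split=> // [|a b aI Iab].
  split=> // TI; apply: nFI.
  by have -> : I = [set: R] by apply/seteqP; split.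
apply: contrapT => /not_orP [nIa nIb]; apply: nFI; apply: (oka I a) => //.
- apply: Max_right_ideals_outside_sub hI _ _ _ nIa.
  + exact: right_ideal_add_principal.
  + exact: sub_add_principal.
  + exact: add_principal_gen.
- apply: Max_right_ideals_outside_sub hI _ _ _ nIb => //.
  + exact: right_ideal_colon.
  + by move=> x Ix; apply: aI; exists x.
Qed.
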